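(* Let $m\ge\ell\ge 1$ be integers, let $\mathbf{x}=(x_1,\dots,x_n)$ and $\mathbf{t}=(t_1,\dots,t_{\ell-1})$ be commuting indeterminates, and let $t_\ell$ be a further indeterminate. Then $$s_{m^\ell}(\mathbf{x},\mathbf{t},t_\ell)=\sum_{\lambda\subseteq m^\ell}\ \prod_{i=1}^{\ell}t_i^{m-\lambda_i}\ g_\lambda(\mathbf{x};\mathbf{t}).$$
   Context: $m^\ell$ is the rectangular partition with $\ell$ parts equal to $m$, and the sum is over all partitions $\lambda=(\lambda_1\ge\dots\ge\lambda_\ell\ge0)$ with $\lambda_1\le m$. $s_{m^\ell}(\mathbf{x},\mathbf{t},t_\ell)$ is the Schur polynomial in the variables $x_1,\dots,x_n,t_1,\dots,t_\ell$. A reverse plane partition of shape $\lambda$ (English convention, row 1 at the top) is a filling of the boxes of $\lambda$ with positive integers that weakly increases along rows and down columns. Let $\mathrm{RPP}^n(\lambda)$ be the set of those with all entries at most $n$. For $T\in\mathrm{RPP}^n(\lambda)$, let $a_i$ be the number of columns of $T$ containing $i$, and let $b_r$ be the number of boxes in row $r$ whose entry equals the entry in the box directly below. The refined dual Grothendieck polynomial is $g_\lambda(\mathbf{x};\mathbf{t}):=\sum_{T\in\mathrm{RPP}^n(\lambda)}\prod_{r}t_r^{b_r}\prod_{i}x_i^{a_i}$ (only $t_1,\dots,t_{\ell(\lambda)-1}$ occur). *)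

(* Defs.v *)
From HB Require Import structures.
From mathcomp Require Import all_boot all_order all_algebra.
From mathcomp Require Export mpoly.

Set Implicit Arguments.
Unset Strict Implicit.
Unset Printing Implicit Defensive.

Import GRing.Theory.
Local Open Scope ring_scope.

(* A partition is a weakly decreasing [seq nat], trailing zeros allowed.      *)
(* Rows and columns are numbered from 0, row 0 being the top one; an entry    *)
(* [i : 'I_n] stands for the positive integer i + 1.                          *)

(* The bound [head 0 lam] on columns only serves to make the type finite: it  *)
(* excludes no box, since the first part of a partition is the largest.       *)
Definition box (lam : seq nat) : finType :=
  {b : 'I_(size lam) * 'I_(head 0 lam)%N | (b.2 < nth 0 lam b.1)%N}.

Definition brow (lam : seq nat) (b : box lam) : 'I_(size lam) := (val b).1.
Definition bcol (lam : seq nat) (b : box lam) : 'I_(head 0 lam)%N := (val b).2.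

Definition filling (lam : seq nat) (n : nat) : finType :=
  {ffun box lam -> 'I_n}.

Section Fillings.

Variables (lam : seq nat) (n : nat).
Implicit Types T : filling lam n.

Definition row_weak T : bool :=
  [forall b : box lam, forall b' : box lam,
    (brow b == brow b') && (bcol b <= bcol b')%N ==> (T b <= T b')%N].

Definition col_weak T : bool :=
  [forall b : box lam, forall b' : box lam,
    (bcol b == bcol b') && (brow b <= brow b')%N ==> (T b <= T b')%N].

Definition col_strict T : bool :=
  [forall b : box lam, forall b' : box lam,
    (bcol b == bcol b') && (brow b < brow b')%N ==> (T b < T b')%N].

Definition ssyt T : bool := row_weak T && col_strict T.

Definition rpp T : bool := row_weak T && col_weak T.

Definition num_cols T (i : 'I_n) : nat :=
  #|[set c : 'I_(head 0 lam)%N |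
      [exists b : box lam, (bcol b == c) && (T b == i)]]|.

Definition num_repeats T (r : nat) : nat :=
  #|[set b : box lam | (brow b == r :> nat) &&
      [exists b' : box lam,
        [&& brow b' == r.+1 :> nat, bcol b' == bcol b & T b == T b']]]|.

End Fillings.

Definition schur (R : comNzRingType) (N : nat) (lam : seq nat)
    (z : 'I_N -> R) : R :=
  \sum_(T : filling lam N | ssyt T) \prod_(b : box lam) z (T b).

(* Row r carries the parameter t_r. The bottom row needs none, so this is     *)
(* g_lam(x; t) as soon as k is at least the number of nonzero parts minus 1.  *)
Definition dual_grothendieck (R : comNzRingType) (n k : nat) (lam : seq nat)
    (x : 'I_n -> R) (t : 'I_k -> R) : R :=
  \sum_(T : filling lam n | rpp T)
    (\prod_(r < k) t r ^+ num_repeats T r) *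
    (\prod_(i < n) x i ^+ num_cols T i).

(* lam = (lam_1 >= ... >= lam_l >= 0) with all parts at most m. *)
Definition in_rect (m l : nat) (lam : l.-tuple 'I_m.+1) : bool :=
  sorted geq (map val lam).

(* Main.v *)
(* Recording the boxes with entry at most i, for each i, turns tableaux into
   chains of partitions, so that both s and g are iterates of one-variable
   operators, and t = 0 turns those of g into those of s. The operator of g with
   parameters t_1, ..., t_j, composed with the removal of horizontal strips,
   weighted by t_j, from the rows below the j-th, equals that removal composed
   with the operator with parameters t_1, ..., t_(j-1): on both sides the
   intermediate partition ranges over a product of intervals, and the
   Bender-Knuth reflection of each interval exchanges the weights. Iterating
   expands g in Schur polynomials. Summing g_lam over lam with the weight of the
   complement of lam in the rectangle amounts to computing g_(m^l) in the
   additional variable t_l. For a rectangle the strips above are arbitrary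
   horizontal strips, so that the result is s_(m^l) in the variables
   x, t_l, t_1, ..., t_(l-1), and the Schur operators commute. *)

Require Import Defs.
From mathcomp Require Import all_boot all_order all_algebra.
From mathcomp Require Import zify.

Set Implicit Arguments.
Unset Strict Implicit.
Unset Printing Implicit Defensive.

Import GRing.Theory.
Local Open Scope ring_scope.

(** * One-variable operators on the partitions inside a rectangle *)

Section Operators.

Variables (m l : nat) (R : comNzRingType).

Local Notation part := (l.-tuple 'I_m.+1).
Implicit Types (a b lam mu nu : part) (f g : part -> R).
Implicit Types (t : nat -> R) (x y : R).

Definition row a (r : nat) : nat := nth 0%N (map val a) r.

(* [row] shifted by one, with an infinite row (cut off at m) on top. *)
Definition prow a (r : nat) : nat := if r is r'.+1 then row a r' else m.

(** [inord] sends values above m to 0, which is why [row_mkpart] asks for a bound on [h]. *)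
Definition mkpart (h : nat -> nat) : part := [tuple inord (h i) | i < l].

Lemma row_tnth a (i : 'I_l) : row a i = tnth a i.
Proof. by rewrite /row (tnth_nth ord0) (nth_map ord0) // size_tuple. Qed.

Lemma row_le a r : (row a r <= m)%N.
Proof.
case: (ltnP r l) => hr; first by rewrite (row_tnth a (Ordinal hr)) -ltnS.
by rewrite /row nth_default // size_map size_tuple.
Qed.

Lemma row_ge a r : (l <= r)%N -> row a r = 0%N.
Proof. by move=> hr; rewrite /row nth_default // size_map size_tuple. Qed.

Lemma prow_le a r : (prow a r <= m)%N.
Proof. by case: r => // r; apply: row_le. Qed.

Lemma row_mkpart h r : (r < l)%N -> (h r <= m)%N -> row (mkpart h) r = h r.
Proof.
by move=> hr hm; rewrite (row_tnth _ (Ordinal hr)) tnth_mktuple inordK.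
Qed.

Lemma row_inj a b : (forall r, (r < l)%N -> row a r = row b r) -> a = b.
Proof.
move=> h; apply: eq_from_tnth => i; apply: val_inj => /=.
by rewrite -!row_tnth h.
Qed.

Lemma in_rectP a : reflect (forall r, (row a r.+1 <= row a r)%N) (in_rect a).
Proof.
rewrite /in_rect; apply: (iffP (sortedP 0%N)) => h r.
  case: (ltnP r.+1 l) => hr; last by rewrite row_ge.
  by apply: h; rewrite size_map size_tuple.
by move=> _; apply: h.
Qed.

Lemma prow_ge a r : in_rect a -> (row a r <= prow a r)%N.
Proof. by case: r => [|r] /in_rectP h; [apply: row_le | apply: h]. Qed.

Definition sub_part mu lam : bool := [forall r : 'I_l, row mu r <= row lam r]%N.

Lemma sub_partP mu lam :
  reflect (forall r, (row mu r <= row lam r)%N) (sub_part mu lam).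
Proof.
apply: (iffP forallP) => h r; last exact: h.
by case: (ltnP r l) => hr; [apply: (h (Ordinal hr)) | rewrite row_ge].
Qed.

Lemma prow_sub mu lam r : sub_part mu lam -> (prow mu r <= prow lam r)%N.
Proof. by move/sub_partP=> h; case: r => //=. Qed.

(** The skew shape lam/mu is a horizontal strip confined to the rows from j on. *)
Definition strip (j : nat) lam mu : bool :=
  [forall r : 'I_l, (row mu r <= row lam r)%N &&
    (if (r < j)%N then row mu r == row lam r else row lam r.+1 <= row mu r)%N].

Lemma stripP j lam mu :
  reflect [/\ forall r, (row mu r <= row lam r)%N,
             forall r, (r < j)%N -> row mu r = row lam r
           & forall r, (j <= r)%N -> (row lam r.+1 <= row mu r)%N]
          (strip j lam mu).
Proof.
apply: (iffP forallP) => [h | [h1 h2 h3] r].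
  have h' r : (row mu r <= row lam r)%N &&
      (if (r < j)%N then row mu r == row lam r
       else row lam r.+1 <= row mu r)%N.
    case: (ltnP r l) => hr; first exact: (h (Ordinal hr)).
    by rewrite !row_ge ?leqW // eqxx if_same.
  split=> r; first by case/andP: (h' r).
    by move=> hr; case/andP: (h' r) => _; rewrite hr => /eqP.
  by move=> hr; case/andP: (h' r) => _; rewrite ltnNge hr.
rewrite h1 /=; case: ltnP => hr; first by rewrite h2.
exact: h3.
Qed.

Definition size_diff lam mu : nat :=
  (\sum_(0 <= r < l) (row lam r - row mu r))%N.

(* The one-variable skew polynomial g_{lam/mu}(x; t), the parameter of row r
   being t_{r+1}: the exponent of x counts the columns of lam/mu by their
   lowest box, and [t 0] always has exponent 0. *)
Definition skew_g (x : R) t lam mu : R :=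
  \prod_(0 <= r < l.+1) (x ^+ (prow lam r - maxn (row lam r) (prow mu r)) *
                         t r ^+ (row lam r - prow mu r)).

Definition g_op (x : R) t f lam : R :=
  \sum_(mu : part | in_rect mu && sub_part mu lam) skew_g x t lam mu * f mu.

Definition strip_op (j : nat) (y : R) f lam : R :=
  \sum_(mu : part | in_rect mu && strip j lam mu) y ^+ size_diff lam mu * f mu.

Lemma eq_g_op x t f g lam :
  (forall mu, in_rect mu -> f mu = g mu) -> g_op x t f lam = g_op x t g lam.
Proof. by move=> h; apply: eq_bigr => mu /andP[/h->]. Qed.

Lemma eq_strip_op j y f g lam :
    (forall mu, in_rect mu -> strip j lam mu -> f mu = g mu) ->
  strip_op j y f lam = strip_op j y g lam.
Proof. by move=> h; apply: eq_bigr => mu /andP[h1 h2]; rewrite h. Qed.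

(** As [t 0] always has exponent 0, this keeps t_1, ..., t_(j-1), and the truncations at 0 and at 1
    give the same weights. *)
Definition trunc (j : nat) t (r : nat) : R := if (r < j)%N then t r else 0.

(** The exponent at r = 0 vanishes because rows are at most m, the one at r = l because row l is
    empty. *)
Lemma eq_skew_g x t t' lam mu :
    (forall r, (0 < r < l)%N -> t r = t' r) ->
  skew_g x t lam mu = skew_g x t' lam mu.
Proof.
move=> h; apply: eq_big_nat => r /andP[_ hr]; congr (_ * _).
case: (posnP r) => [-> | r_gt0].
  by rewrite /= (eqP (_ : row lam 0 - m == 0)%N) // subn_eq0 row_le.
case: (ltnP r l) => hr'; first by rewrite h // r_gt0.
by rewrite row_ge.
Qed.

(* Rows from j on carry the parameter 0, hence no repetition between them. *)
Lemma skew_g_trunc x t j lam mu :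
    sub_part mu lam -> (j <= l)%N ->
  skew_g x (trunc j t) lam mu =
    if [forall r : 'I_l, (j <= r)%N ==> (row lam r <= prow mu r)%N] then
      \prod_(0 <= r < j) (x ^+ (prow lam r - maxn (row lam r) (prow mu r)) *
                         t r ^+ (row lam r - prow mu r)) *
      x ^+ (\sum_(j <= r < l.+1) (prow lam r - prow mu r))%N
    else 0.
Proof.
move=> hsub hj; rewrite /skew_g; case: ifPn => [/forallP h | ].
  rewrite (@big_cat_nat _ _ _ j) //=; last exact: leqW.
  congr (_ * _); first by apply: eq_big_nat => r /andP[_ hr]; rewrite /trunc hr.
  rewrite expr_sum; apply: eq_big_nat => r /andP[hr hr'].
  have {}h : (row lam r <= prow mu r)%N.
    case: (ltnP r l) => hrl; last by rewrite row_ge.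
    by have /implyP := h (Ordinal hrl); apply.
  rewrite /trunc ltnNge hr /= (maxn_idPr h).
  by move: h; rewrite -subn_eq0 => /eqP ->; rewrite expr0 mulr1.
rewrite negb_forall => /existsP[[r hrl]] /=.
rewrite negb_imply -ltnNge => /andP[hr h].
(* A row of lam longer than the row above it in mu contributes a positive power of 0. *)
rewrite (bigD1_seq r) ?iota_uniq //=; last first.
  by rewrite mem_index_iota ltnS /=; apply: ltnW.
rewrite /trunc ltnNge hr /= expr0n subn_eq0 leqNgt h /=.
by rewrite mulr0 mul0r.
Qed.

(** * The Bender-Knuth reflection of intermediate partitions *)

Section BenderKnuth.

Variables (j : nat) (x : R) (t : nat -> R) (lam nu : part).
Hypotheses (hj : (j < l)%N) (hlam : in_rect lam) (hnu : in_rect nu).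
Hypothesis hsub : sub_part nu lam.

(** Interlacing with lam and nu confines row r >= j of mu to the interval from [bk_low r] to
    [bk_high r], in both orders of composition. *)
Definition bk_low r := maxn (row nu r) (row lam r.+1).
Definition bk_high r := minn (row lam r) (prow nu r).

(** [bk_low r] and [bk_high r.+1] are the maximum and the minimum of the same pair [row nu r],
    [row lam r.+1]; the sum is regrouped accordingly. *)
Lemma bk_sum k : (j <= k)%N ->
  (\sum_(j <= r < k) (bk_low r + bk_high r) + bk_high k =
   bk_high j + \sum_(j <= r < k) (row nu r + row lam r.+1))%N.
Proof.
elim: k => [|k IH]; first by rewrite leqn0 => /eqP->; rewrite !big_geq ?addn0.
rewrite leq_eqVlt => /orP[/eqP-> | hk]; first by rewrite !big_geq ?addn0.
have := IH hk; rewrite !big_nat_recr //= /bk_low /bk_high /=.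
set s1 := (\sum_(_ <= _ < _) _)%N; set s2 := (\sum_(_ <= _ < _) _)%N; lia.
Qed.

(* The partitions mu through which both composites pass: rows above j are
   forced, the others range over independent intervals. *)
Definition bk_mid (base mu : part) : bool :=
  [forall r : 'I_l, if (r < j)%N then row mu r == row base r
                    else bk_low r <= row mu r <= bk_high r]%N.

(** Each free row is reflected in its interval; the forced rows are replaced by those of [base],
    which is nu for one order of composition and lam for the other. *)
Definition bk_flip (base mu : part) : part :=
  mkpart (fun r => if (r < j)%N then row base r
                   else bk_low r + bk_high r - row mu r)%N.

Lemma bk_midP base mu :
  reflect ((forall r, (r < j)%N -> row mu r = row base r) /\
           (forall r, (j <= r < l)%N -> (bk_low r <= row mu r <= bk_high r)%N))
          (bk_mid base mu).
Proof.
apply: (iffP forallP) => [h | [h1 h2] r].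
  split=> r hr.
    by have := h (Ordinal (ltn_trans hr hj)); rewrite /= hr => /eqP.
  case/andP: hr => hr hrl.
  by have := h (Ordinal hrl); rewrite /= ltnNge hr.
case: ltnP => hr; first by rewrite h1.
by rewrite h2 // hr /=.
Qed.

Lemma row_bk_flip base mu mu' r : bk_mid base mu -> (r < l)%N ->
  row (bk_flip mu' mu) r = if (r < j)%N then row mu' r
                           else (bk_low r + bk_high r - row mu r)%N.
Proof.
move=> /bk_midP[h1 h2] hr; rewrite row_mkpart //; case: ltnP => hr'.
  exact: row_le.
have /h2 : (j <= r < l)%N by rewrite hr'.
have := row_le lam r; rewrite /bk_high; lia.
Qed.

Lemma bk_flip_mid base mu mu' : bk_mid base mu -> bk_mid mu' (bk_flip mu' mu).
Proof.
move=> h; have /bk_midP[h1 h2] := h; apply/bk_midP; split=> r hr.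
  by rewrite (row_bk_flip _ h) ?hr // (ltn_trans hr).
have := h2 r hr; case/andP: hr => hr hrl.
rewrite (row_bk_flip _ h) // ltnNge hr /=; lia.
Qed.

Lemma bk_flipK base mu mu' :
  bk_mid base mu -> bk_flip base (bk_flip mu' mu) = mu.
Proof.
move=> h; have /bk_midP[h1 h2] := h; apply: row_inj => r hr.
rewrite (row_bk_flip _ (bk_flip_mid mu' h)) //.
case: ltnP => hr'; first by rewrite h1.
have /h2 : (j <= r < l)%N by rewrite hr'.
rewrite (row_bk_flip _ h) // ltnNge hr' /=; lia.
Qed.

(** Here mu is reached by [g_op], and the strip mu/nu follows. The last condition says that no
    truncated parameter occurs in the weight of lam/mu. *)
Lemma bk_mid_left mu :
  [&& in_rect mu, sub_part mu lam, strip j mu nu &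
    [forall r : 'I_l, (j.+1 <= r)%N ==> (row lam r <= prow mu r)%N]] =
  bk_mid nu mu.
Proof.
apply/and4P/bk_midP => [|[h1 h2]].
  case=> /in_rectP h1 /sub_partP h2 /stripP[h3 h4 h5] /forallP h6.
  split=> r hr; first by rewrite h4.
  case/andP: hr => hr hrl; rewrite geq_max leq_min h3 h2 /=.
  apply/andP; split.
    case: (ltnP r.+1 l) => hrl'; last by rewrite row_ge.
    by have /implyP := h6 (Ordinal hrl'); apply.
  case: r hr hrl => [|r] hr hrl; first exact: row_le.
  (* In the first case [r.+1 = j], and mu_j <= mu_(j-1) = nu_(j-1). *)
  case: (ltnP r j) => hr'; first by rewrite /= h4 // h1.
  by rewrite /= h5.
have hr r : (j <= r)%N -> (row nu r <= row mu r)%N /\ (row mu r <= row lam r)%N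
    /\ (row lam r.+1 <= row mu r)%N /\ (row mu r <= prow nu r)%N.
  move=> hr; case: (ltnP r l) => hrl; last by rewrite !row_ge // leqW.
  by have := h2 r; rewrite hr hrl /bk_low /bk_high => /(_ isT); lia.
split.
- apply/in_rectP => r; case: (ltnP r j) => hr'; last first.
    have [h3 _] := hr r hr'.
    by have [_ [_ [_ h4]]] := hr r.+1 (leqW hr'); exact: leq_trans h4 h3.
  rewrite [row mu r]h1 //; case: (ltnP r.+1 j) => hr''.
    by rewrite h1 //; apply/in_rectP.
  by have [_ [_ [_ h4]]] := hr r.+1 hr''.
- apply/sub_partP => r; case: (ltnP r j) => hr'.
    by rewrite h1 //; apply/sub_partP.
  by case: (hr r hr') => _ [].
- apply/stripP; split=> r.
  + case: (ltnP r j) => hr'; last by case: (hr r hr').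
    by rewrite h1.
  + by move=> /h1.
  + by move=> hr'; case: (hr r.+1 (leqW hr')) => _ [_ []].
apply/forallP => -[[|r] hrl] //=; apply/implyP => hr'.
by case: (hr r hr') => _ [_ []].
Qed.

(** The opposite order: the strip lam/mu comes first, so the forced rows are those of lam, and the
    last condition now concerns the weight of mu/nu. *)
Lemma bk_mid_right mu :
  [&& in_rect mu, sub_part nu mu, strip j lam mu &
    [forall r : 'I_l, (j <= r)%N ==> (row mu r <= prow nu r)%N]] =
  bk_mid lam mu.
Proof.
apply/and4P/bk_midP => [|[h1 h2]].
  case=> /in_rectP h1 /sub_partP h2 /stripP[h3 h4 h5] /forallP h6.
  split=> r hr; first by rewrite h4.
  case/andP: hr => hr hrl; rewrite geq_max leq_min h3 h2 h5 //=.
  by have /implyP := h6 (Ordinal hrl); apply.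
have hr r : (j <= r)%N -> (row nu r <= row mu r)%N /\ (row mu r <= row lam r)%N
    /\ (row lam r.+1 <= row mu r)%N /\ (row mu r <= prow nu r)%N.
  move=> hr; case: (ltnP r l) => hrl; last by rewrite !row_ge // leqW.
  by have := h2 r; rewrite hr hrl /bk_low /bk_high => /(_ isT); lia.
split.
- apply/in_rectP => r; case: (ltnP r j) => hr'; last first.
    have [h3 _] := hr r hr'.
    by have [_ [_ [_ h4]]] := hr r.+1 (leqW hr'); exact: leq_trans h4 h3.
  rewrite [row mu r]h1 //; case: (ltnP r.+1 j) => hr''.
    by rewrite h1 //; apply/in_rectP.
  (* At the boundary row, mu_j <= lam_j <= lam_(j-1) = mu_(j-1). *)
  have [_ [h4 _]] := hr r.+1 hr''; apply: leq_trans h4 _.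
  exact/in_rectP.
- apply/sub_partP => r; case: (ltnP r j) => hr'; last by case: (hr r hr').
  by rewrite h1 //; apply/sub_partP.
- apply/stripP; split=> r.
  + case: (ltnP r j) => hr'; last by case: (hr r hr') => _ [].
    by rewrite h1.
  + by move=> /h1.
  + by move=> hr'; case: (hr r hr') => _ [_ []].
apply/forallP => -[r hrl] //=; apply/implyP => hr'.
by case: (hr r hr') => _ [_ []].
Qed.

(** The factors of the rows above j, common to both orders: there mu agrees with nu in one and with
    lam in the other. *)
Let bk_core : R := \prod_(0 <= r < j)
  (x ^+ (prow lam r - maxn (row lam r) (prow nu r)) *
   t r ^+ (row lam r - prow nu r)).

Lemma size_diffE mu mu' : (forall r, (r < j)%N -> row mu r = row mu' r) ->
  size_diff mu mu' = (\sum_(j <= r < l) (row mu r - row mu' r))%N.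
Proof.
move=> h; rewrite /size_diff (@big_cat_nat _ _ _ j) ?(ltnW hj) //=.
rewrite big_nat_cond big1 ?add0n // => r /andP[/andP[_ hr] _].
by rewrite h // subnn.
Qed.

Lemma bk_weight_left mu : bk_mid nu mu ->
  (if [forall r : 'I_l, (j.+1 <= r)%N ==> (row lam r <= prow mu r)%N] then
     \prod_(0 <= r < j.+1) (x ^+ (prow lam r - maxn (row lam r) (prow mu r)) *
                         t r ^+ (row lam r - prow mu r)) *
      x ^+ (\sum_(j.+1 <= r < l.+1) (prow lam r - prow mu r))%N
   else 0) * t j ^+ size_diff mu nu =
  bk_core * x ^+ ((prow lam j - maxn (row lam j) (prow nu j)) +
                  \sum_(j <= r < l) (row lam r - row mu r)) *
            t j ^+ ((row lam j - prow nu j) +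
                  \sum_(j <= r < l) (row mu r - row nu r)).
Proof.
move=> h; have := h; rewrite -bk_mid_left => /and4P[_ _ _ ->].
case/bk_midP: h => h1 h2.
have hp r : (r <= j)%N -> prow mu r = prow nu r by case: r => //= r; apply: h1.
rewrite size_diffE // big_nat_recr //= big_add1 /= hp //.
rewrite (_ : \prod_(_ <= _ < j) _ = bk_core); last first.
  by apply: eq_big_nat => r /andP[_ hr]; rewrite hp // ltnW.
by rewrite !exprD -!mulrA [X in _ * (_ * X)]mulrCA.
Qed.

Lemma bk_weight_right mu : bk_mid lam mu ->
  t j ^+ size_diff lam mu *
  (if [forall r : 'I_l, (j <= r)%N ==> (row mu r <= prow nu r)%N] then
     \prod_(0 <= r < j) (x ^+ (prow mu r - maxn (row mu r) (prow nu r)) *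
                         t r ^+ (row mu r - prow nu r)) *
      x ^+ (\sum_(j <= r < l.+1) (prow mu r - prow nu r))%N
   else 0) =
  bk_core * x ^+ ((prow lam j - prow nu j) +
                  \sum_(j <= r < l) (row mu r - row nu r)) *
            t j ^+ (\sum_(j <= r < l) (row lam r - row mu r))%N.
Proof.
move=> h; have := h; rewrite -bk_mid_right => /and4P[_ _ _ ->].
case/bk_midP: h => h1 h2.
have hp r : (r <= j)%N -> prow mu r = prow lam r by case: r => //= r; apply: h1.
rewrite size_diffE => [|r hr]; last by rewrite h1.
rewrite [in X in x ^+ X]big_ltn; last exact: ltnW.
rewrite big_add1 /= hp //.
rewrite (_ : \prod_(_ <= _ < j) _ = bk_core); first by rewrite mulrC.
by apply: eq_big_nat => r /andP[_ hr]; rewrite hp ?h1 // ltnW.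
Qed.

(** By [bk_sum], reflection exchanges the sizes of lam/mu and mu/nu up to [row lam j - bk_high j].
    The factors of row j absorb this difference, since the minimum and the maximum of [row lam j]
    and [prow nu j] add up to their sum. *)
Lemma bk_exponents base mu mu' : bk_mid base mu ->
    (forall r, (j <= r < l)%N ->
       row mu' r = (bk_low r + bk_high r - row mu r)%N) ->
  ((prow lam j - maxn (row lam j) (prow nu j)) +
     \sum_(j <= r < l) (row lam r - row mu' r) =
   (prow lam j - prow nu j) + \sum_(j <= r < l) (row mu r - row nu r))%N /\
  ((row lam j - prow nu j) + \sum_(j <= r < l) (row mu' r - row nu r) =
   \sum_(j <= r < l) (row lam r - row mu r))%N.
Proof.
move=> /bk_midP[_ h] h'.
have hs := bk_sum (ltnW hj).
have hhl : bk_high l = 0%N by rewrite /bk_high row_ge // min0n.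
rewrite hhl addn0 [in RHS]big_split /= in hs.
have e0 : (\sum_(j <= r < l) row lam r.+1 + row lam j =
           \sum_(j <= r < l) row lam r)%N.
  have := @big_add1 _ 0%N addn j l.+1 xpredT (row lam) => /= <-.
  rewrite addnC -big_ltn ?ltnS ?(ltnW hj) // big_nat_recr ?(ltnW hj) //=.
  by rewrite row_ge ?addn0.
have e1 : (\sum_(j <= r < l) (row lam r - row mu' r) +
           \sum_(j <= r < l) (bk_low r + bk_high r) =
  \sum_(j <= r < l) row lam r + \sum_(j <= r < l) row mu r)%N.
  rewrite -!big_split /=; apply: eq_big_nat => r hr.
  by rewrite h' //; have := h r hr; rewrite /bk_high; lia.
have e2 : (\sum_(j <= r < l) (row mu r - row nu r) +
           \sum_(j <= r < l) row nu r = \sum_(j <= r < l) row mu r)%N.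
  rewrite -!big_split /=; apply: eq_big_nat => r hr.
  by have := h r hr; rewrite /bk_low /=; lia.
have e3 : (\sum_(j <= r < l) (row mu' r - row nu r) +
           (\sum_(j <= r < l) row mu r + \sum_(j <= r < l) row nu r) =
           \sum_(j <= r < l) (bk_low r + bk_high r))%N.
  rewrite -!big_split /=; apply: eq_big_nat => r hr.
  by rewrite h' //; have := h r hr; rewrite /bk_low /=; lia.
have e4 : (\sum_(j <= r < l) (row lam r - row mu r) +
           \sum_(j <= r < l) row mu r = \sum_(j <= r < l) row lam r)%N.
  rewrite -!big_split /=; apply: eq_big_nat => r hr.
  by have := h r hr; rewrite /bk_high /=; lia.
have := prow_sub j hsub; have := prow_ge j hlam.
have : bk_high j = minn (row lam j) (prow nu j) by [].
lia.
Qed.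

(** The coefficients of [f nu] in the two composites. Terms outside [bk_mid] vanish, and the
    reflection matches the remaining ones. *)
Lemma bk_kernel :
  \sum_(mu : part | [&& in_rect mu, sub_part mu lam & strip j mu nu])
     skew_g x (trunc j.+1 t) lam mu * t j ^+ size_diff mu nu =
  \sum_(mu : part | [&& in_rect mu, sub_part nu mu & strip j lam mu])
     t j ^+ size_diff lam mu * skew_g x (trunc j t) mu nu.
Proof.
pose WL mu := bk_core * x ^+ ((prow lam j - maxn (row lam j) (prow nu j)) +
                  \sum_(j <= r < l) (row lam r - row mu r)) *
            t j ^+ ((row lam j - prow nu j) +
                  \sum_(j <= r < l) (row mu r - row nu r)).
pose WR mu := bk_core * x ^+ ((prow lam j - prow nu j) +
                  \sum_(j <= r < l) (row mu r - row nu r)) *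
            t j ^+ (\sum_(j <= r < l) (row lam r - row mu r))%N.
transitivity (\sum_(mu : part | bk_mid nu mu) WL mu).
  rewrite big_mkcond [RHS]big_mkcond; apply: eq_bigr => mu _.
  case: (boolP (bk_mid nu mu)) => h.
    have := h; rewrite -bk_mid_left => /and4P[h1 h2 h3 _].
    by rewrite h1 h2 h3 skew_g_trunc // bk_weight_left.
  case: ifP => // /and3P[h1 h2 h3]; rewrite skew_g_trunc //.
  by move: h; rewrite -bk_mid_left h1 h2 h3 /= => /negbTE ->; rewrite mul0r.
transitivity (\sum_(mu : part | bk_mid lam mu) WR mu); last first.
  rewrite big_mkcond [RHS]big_mkcond; apply: eq_bigr => mu _.
  case: (boolP (bk_mid lam mu)) => h.
    have := h; rewrite -bk_mid_right => /and4P[h1 h2 h3 _].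
    by rewrite h1 h2 h3 skew_g_trunc ?bk_weight_right // ltnW.
  case: ifP => // /and3P[h1 h2 h3]; rewrite skew_g_trunc ?(ltnW hj) //.
  by move: h; rewrite -bk_mid_right h1 h2 h3 /= => /negbTE ->; rewrite mulr0.
(* [bk_flip nu] carries the intermediate partitions of the right side to those of the left side,
   with inverse [bk_flip lam]. *)
rewrite (reindex_onto (bk_flip nu) (bk_flip lam)) => [|mu h]; last first.
  exact: bk_flipK h.
apply: eq_big => [mu | mu /andP[h /eqP h']].
  apply/andP/idP => [[h /eqP <-] | h]; first exact: bk_flip_mid h.
  by split; [exact: bk_flip_mid h | apply/eqP; exact: bk_flipK h].
have {h'}h : bk_mid lam mu by rewrite -h'; exact: bk_flip_mid h.
have [|e1 e2] := bk_exponents h (mu' := bk_flip nu mu).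
  by move=> r /andP[hr hrl]; rewrite (row_bk_flip _ h) // ltnNge hr.
by rewrite /WL /WR e1 e2.
Qed.

End BenderKnuth.

(** * Commutation relations *)

(** Coefficients of [f nu] are compared: for nu inside lam this is [bk_kernel], and otherwise no
    intermediate partition exists. *)
Lemma g_strip_comm j x t f lam : (j < l)%N -> in_rect lam ->
  g_op x (trunc j.+1 t) (strip_op j (t j) f) lam =
  strip_op j (t j) (g_op x (trunc j t) f) lam.
Proof.
move=> hj hlam; rewrite /g_op /strip_op.
under eq_bigr do rewrite mulr_sumr.
under [RHS]eq_bigr do rewrite mulr_sumr.
rewrite (exchange_big_dep (@in_rect m l)) /=; last by move=> ? ? _ /andP[].
rewrite [RHS](exchange_big_dep (@in_rect m l)) /=; last by move=> ? ? _ /andP[].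
apply: eq_bigr => nu hnu.
under eq_bigr do rewrite mulrA.
under [RHS]eq_bigr do rewrite mulrA.
rewrite -!mulr_suml; congr (_ * _).
have [hsub | hsub] := boolP (sub_part nu lam).
  under eq_bigl do rewrite hnu /= -andbA.
  under [RHS]eq_bigl do rewrite hnu /= -andbA [X in _ && X]andbC.
  exact: bk_kernel.
rewrite !big_pred0 // => mu; apply/negP.
  case/andP=> /andP[_ /stripP[h1 _ _]] /andP[_ /sub_partP h2].
  by case/negP: hsub; apply/sub_partP => r; apply: leq_trans (h2 r) (h1 r).
case/andP=> /andP[_ /sub_partP h1] /andP[_ /stripP[h2 _ _]].
by case/negP: hsub; apply/sub_partP => r; apply: leq_trans (h2 r) (h1 r).
Qed.

(** With all parameters 0, only horizontal strips lam/mu survive, and their columns contain one box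
    each. *)
Lemma g_op_strip x t f lam : in_rect lam ->
  g_op x (trunc 0 t) f lam = strip_op 0 x f lam.
Proof.
move=> hlam; rewrite /g_op /strip_op big_mkcond [RHS]big_mkcond.
apply: eq_bigr => mu _; case hmu: (in_rect mu) => //=.
have -> : strip 0 lam mu = sub_part mu lam &&
    [forall r : 'I_l, (0 <= r)%N ==> (row lam r <= prow mu r)%N].
  apply/stripP/andP => [[h1 _ h2] | [/sub_partP h1 /forallP h2]].
    split; first exact/sub_partP.
    by apply/forallP => -[[|r] hr] /=; rewrite ?row_le ?h2.
  split=> // r _; case: (ltnP r.+1 l) => hr; last by rewrite row_ge.
  exact: (h2 (Ordinal hr)).
case: ifP => //= hsub; rewrite skew_g_trunc //.
case: ifP => // _; last exact: mul0r.
by rewrite big_geq // mul1r big_ltn // subnn add0n big_add1.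
Qed.

(** This is the case j = 0 of [g_strip_comm]: the truncations at 1 and at 0 both turn [g_op] into a
    strip operator. *)
Lemma strip_op_comm x y f lam : in_rect lam ->
  strip_op 0 x (strip_op 0 y f) lam = strip_op 0 y (strip_op 0 x f) lam.
Proof.
move=> hlam; have [hl | hl] := posnP l; last first.
  pose t (_ : nat) := y; rewrite -(g_op_strip x t) //.
  transitivity (g_op x (trunc 1 t) (strip_op 0 (t 0%N) f) lam).
    apply: eq_bigr => mu _; congr (_ * _).
    by apply: eq_skew_g => -[|r].
  rewrite g_strip_comm //; apply: eq_strip_op => mu hmu _.
  exact: g_op_strip.
(* For l = 0 there is only the empty partition, and strip operators are the identity. *)
have triv z g : strip_op 0 z g lam = g lam.
  rewrite /strip_op (big_pred1 lam) => [|mu] /=.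
    by rewrite /size_diff hl big_geq // mul1r.
  have -> : mu = lam by apply: row_inj; rewrite hl.
  rewrite eqxx hlam; apply/stripP; split=> // r _.
  by rewrite !row_ge // hl.
by rewrite !triv.
Qed.

(** * Iterated operators and the Schur expansion of g *)

(** The outermost operator belongs to the largest entry, whose boxes are taken off first. *)
Fixpoint g_iter t (xs : nat -> R) (n : nat) f : part -> R :=
  if n is k.+1 then g_op (xs k) t (g_iter t xs k f) else f.

Fixpoint schur_iter (xs : nat -> R) (n : nat) f : part -> R :=
  if n is k.+1 then strip_op 0 (xs k) (schur_iter xs k f) else f.

(* The transition from the g_lam to the Schur polynomials: a sum over chains
   of horizontal strips, i.e. over elegant fillings. *)
Fixpoint elegant t (k : nat) f : part -> R :=
  if k is k'.+1 then strip_op k (t k) (elegant t k' f) else f.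

Lemma eq_g_iter t t' xs xs' n f g lam :
    (forall r, (0 < r < l)%N -> t r = t' r) ->
    (forall i, (i < n)%N -> xs i = xs' i) ->
    (forall mu, in_rect mu -> f mu = g mu) -> in_rect lam ->
  g_iter t xs n f lam = g_iter t' xs' n g lam.
Proof.
move=> ht + hf; elim: n lam => [|n IH] lam hx hlam /=; first exact: hf.
rewrite hx // /g_op; apply: eq_bigr => mu /andP[hmu _].
rewrite (eq_skew_g _ _ _ ht) IH // => i hi.
by rewrite hx // ltnS ltnW.
Qed.

Lemma eq_schur_iter xs xs' n f g lam :
    (forall i, (i < n)%N -> xs i = xs' i) ->
    (forall mu, in_rect mu -> f mu = g mu) -> in_rect lam ->
  schur_iter xs n f lam = schur_iter xs' n g lam.
Proof.
move=> + hf; elim: n lam => [|n IH] lam hx hlam /=; first exact: hf.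
rewrite hx //; apply: eq_strip_op => mu hmu _; rewrite IH // => i hi.
by rewrite hx // ltnS ltnW.
Qed.

Lemma schur_iterD xs n k f :
  schur_iter xs (n + k) f =
  schur_iter (fun i => xs (n + i)%N) k (schur_iter xs n f).
Proof. by elim: k => [|k IH]; rewrite ?addn0 // addnS /= IH. Qed.

Lemma g_iter_schur xs n f lam : in_rect lam ->
  g_iter (fun=> 0) xs n f lam = schur_iter xs n f lam.
Proof.
elim: n lam => //= n IH lam hlam; rewrite -(g_op_strip _ (fun=> 0)) //.
by rewrite (eq_g_op _ _ _ IH).
Qed.

Lemma schur_iter_strip x xs n f lam : in_rect lam ->
  schur_iter xs n (strip_op 0 x f) lam = strip_op 0 x (schur_iter xs n f) lam.
Proof.
elim: n lam => //= n IH lam hlam; rewrite strip_op_comm //.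
by apply: eq_strip_op => mu hmu _; exact: IH.
Qed.

(** Passing each strip operator lowers the truncation by one; at 1 only the Schur operator is
    left. *)
Lemma g_op_elegant x t k f lam : (k < l)%N -> in_rect lam ->
  g_op x (trunc k.+1 t) (elegant t k f) lam =
  elegant t k (strip_op 0 x f) lam.
Proof.
elim: k lam => [|k IH] lam hk hlam /=.
  rewrite -(g_op_strip _ t) //; apply: eq_bigr => mu _; congr (_ * _).
  by apply: eq_skew_g => -[|r].
rewrite g_strip_comm //; apply: eq_strip_op => mu hmu _.
by apply: IH => //; exact: ltnW.
Qed.

(** For k = l - 1 and [f] the indicator of the empty partition, this and [elegant_empty] expand
    g_lam in Schur polynomials. *)
Lemma g_iter_elegant t xs n k f lam : (k < l)%N -> in_rect lam ->
  g_iter (trunc k.+1 t) xs n (elegant t k f) lam =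
  elegant t k (schur_iter xs n f) lam.
Proof.
move=> hk; elim: n lam => //= n IH lam hlam.
by rewrite (eq_g_op _ _ _ IH) g_op_elegant.
Qed.

Definition empty_part : part := mkpart (fun=> 0%N).
(** The starting function of the iterates: chains of shapes begin at the empty partition. *)
Definition empty_delta lam : R := (lam == empty_part)%:R.

Lemma row_empty r : row empty_part r = 0%N.
Proof. by case: (ltnP r l) => hr; [rewrite row_mkpart | rewrite row_ge]. Qed.

Lemma in_rect_empty : in_rect empty_part.
Proof. by apply/in_rectP => r; rewrite !row_empty. Qed.

(** The strips involved have index at least 1 and keep row 0, so a strip that ends at the empty
    partition also starts there. *)
Lemma elegant_empty t k lam : in_rect lam ->
  elegant t k empty_delta lam = empty_delta lam.
Proof.
elim: k lam => //= k IH lam hlam.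
rewrite (eq_strip_op _ (fun mu hmu _ => IH mu hmu)).
rewrite /strip_op /empty_delta; have [->|hne] := eqVneq lam empty_part.
  rewrite (bigD1 empty_part) ?in_rect_empty /=; last first.
    by apply/stripP; split=> r; rewrite !row_empty.
  rewrite eqxx big1 ?addr0 => [|mu /andP[_ /negbTE->]]; last exact: mulr0.
  by rewrite mulr1 /size_diff big1 // => r _; rewrite subnn.
apply: big1 => mu /andP[_ /stripP[_ h _]].
have [e | _] := eqVneq mu empty_part; last exact: mulr0.
case/eqP: hne; apply: row_inj => r hr; rewrite row_empty.
elim: r hr => [|r IHr] hr; first by rewrite -h // e row_empty.
apply/eqP; rewrite -leqn0 -(IHr (ltnW hr)).
exact/in_rectP.
Qed.

(* A horizontal strip taken off a partition whose first rows are maximal only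
   meets the rows below. *)
Lemma elegant_top t k f lam : (forall r, (r <= k)%N -> row lam r = m) ->
  elegant t k f lam = schur_iter (fun i => t i.+1) k f lam.
Proof.
elim: k lam => //= k IH lam hlam.
rewrite /strip_op; apply: eq_big => [mu | mu /andP[_ /stripP[_ h _]]].
  congr (_ && _); apply/stripP/stripP => -[h1 h2 h3]; split=> // r hr.
    case: (ltnP r k.+1) => hr'; last exact: h3.
    by rewrite h2 // !hlam // ltnW.
    (* Row r + 1 of lam is full as well, so interlacing makes row r of mu full. *)
    apply/eqP; rewrite eqn_leq h1 hlam ?(ltnW hr) //.
    by have := h3 r isT; rewrite hlam.
  exact: h3.
rewrite IH // => r hr; rewrite h // hlam //; exact: leqW.
Qed.

(** * Summation over the rectangle *)

Definition rect_part : part := mkpart (fun=> m).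

Lemma row_rect r : (r < l)%N -> row rect_part r = m.
Proof. by move=> hr; rewrite row_mkpart. Qed.

Lemma in_rect_rect : in_rect rect_part.
Proof.
apply/in_rectP => r; case: (ltnP r.+1 l) => hr; last by rewrite row_ge.
by rewrite !row_rect // ltnW.
Qed.

(* The complement of lam in the rectangle contributes like one more variable
   of g, with value [t l]. *)
Lemma sum_rect t f : (0 < l)%N ->
  \sum_(lam : part | in_rect lam)
    (\prod_(i < l) t i.+1 ^+ (m - tnth lam i)) * f lam =
  g_op (t l) t f rect_part.
Proof.
move=> hl; rewrite /g_op; apply: eq_big => [lam | lam hlam].
  rewrite [X in _ = _ && X](_ : _ = true) ?andbT //.
  apply/sub_partP => r; case: (ltnP r l) => hr; last by rewrite row_ge.
  by rewrite row_rect // row_le.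
congr (_ * _); under eq_bigr do rewrite -row_tnth.
rewrite -(big_mkord xpredT (fun i => t i.+1 ^+ (m - row lam i))) /skew_g.
rewrite [RHS]big_ltn // [X in _ = X * _](_ : _ = 1); last first.
  by rewrite /= (maxn_idPr (row_le _ _)) row_rect // subnn !expr0 mulr1.
rewrite mul1r [RHS]big_add1; apply: eq_big_nat => r /andP[_ hr] /=.
(* For r + 1 < l the factor is a power of the parameter; for r + 1 = l it is a power of the
   additional variable. *)
rewrite row_rect //; case: (ltnP r.+1 l) => hr'.
  by rewrite row_rect // (maxn_idPl (row_le _ _)) subnn mul1r.
rewrite (row_ge _ hr') max0n mulr1; congr (t _ ^+ _).
by apply/eqP; rewrite eqn_leq hr' hr.
Qed.

Lemma sum_g_rect t xs n : (0 < l)%N ->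
  \sum_(lam : part | in_rect lam)
    (\prod_(i < l) t i.+1 ^+ (m - tnth lam i)) * g_iter t xs n empty_delta lam =
  schur_iter (fun i => if (i < n)%N then xs i else t (i - n).+1) (n + l)
    empty_delta rect_part.
Proof.
move=> hl; rewrite sum_rect //.
have el : l.-1.+1 = l by exact: prednK.
have trE r : (0 < r < l)%N -> t r = trunc l.-1.+1 t r.
  by rewrite /trunc el => /andP[_ ->].
(* Truncation at l keeps all weights, and the elegant sum fixes the indicator; inserting both makes
   [g_iter_elegant] applicable. *)
transitivity (g_op (t l) (trunc l.-1.+1 t)
    (g_iter (trunc l.-1.+1 t) xs n (elegant t l.-1 empty_delta)) rect_part).
  apply: eq_bigr => lam /andP[hlam _]; rewrite (eq_skew_g _ _ _ trE).
  congr (_ * _); apply: eq_g_iter => // mu hmu.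
  by rewrite elegant_empty.
have hk : (l.-1 < l)%N by rewrite el.
rewrite (eq_g_op _ _ _ (fun mu hmu => g_iter_elegant _ _ _ _ hk hmu)).
rewrite g_op_elegant ?in_rect_rect // elegant_top => [|r hr]; last first.
  by rewrite row_rect // -el.
have eS f : strip_op 0 (t l) (schur_iter (fun i => t i.+1) l.-1 f) =
            schur_iter (fun i => t i.+1) l f by rewrite -[in RHS]el /= el.
(* The operator of t_l, now innermost among those of the t_i, is moved outermost to give the order
   x, t_1, ..., t_l. *)
rewrite schur_iter_strip ?in_rect_rect // eS schur_iterD.
apply: eq_schur_iter (in_rect_rect) => [i _ | mu hmu].
  by rewrite ltnNge leq_addr addKn.
by apply: eq_schur_iter => // i ->.
Qed.

End Operators.

(** * Weak fillings of the rectangle *)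

Lemma sorted_geq_nth (L : seq nat) r s : sorted geq L -> (r <= s)%N ->
  (nth 0%N L s <= nth 0%N L r)%N.
Proof.
move=> hL hrs; case: (ltnP s (size L)) => hs; last by rewrite nth_default.
have geq_trans : transitive geq.
  by move=> a b c hab hbc; apply: leq_trans hbc hab.
apply: (sorted_leq_nth geq_trans leqnn 0%N hL); rewrite ?inE //.
exact: leq_ltn_trans hs.
Qed.

Lemma card_ord_itv m a b : (b <= m)%N ->
  #|[set c : 'I_m | (a <= c < b)%N]| = (b - a)%N.
Proof.
move=> hb; rewrite -sum1dep_card -[RHS]muln1 -sum_nat_const_nat.
rewrite (big_nat_widen _ _ m) //.
by rewrite big_geq_mkord; apply: eq_bigl => i; rewrite andbC.
Qed.

(** A set of columns closed to the left is an initial segment, hence determined by its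
    cardinality. *)
Lemma lt_card_ord m (P : pred 'I_m) (c : 'I_m) :
  (forall c' d : 'I_m, (c' <= d)%N -> P d -> P c') ->
  (c < #|[set d | P d]|)%N = P c.
Proof.
move=> hP; case: (boolP (P c)) => hc.
  have /subset_leq_card :
      [set d : 'I_m | (0 <= d < c.+1)%N] \subset [set d | P d].
    by apply/subsetP => d; rewrite !inE => /= hd; apply: hP hc.
  by rewrite card_ord_itv // subn0.
apply/negbTE; rewrite -leqNgt.
have /subset_leq_card : [set d | P d] \subset [set d : 'I_m | (0 <= d < c)%N].
  apply/subsetP => d; rewrite !inE => /= hd; rewrite ltnNge.
  by apply: contra hc => hcd; apply: hP hd.
by rewrite card_ord_itv ?subn0 // ltnW.
Qed.

Section Tableaux.

Variables (m l : nat).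

Local Notation part := (l.-tuple 'I_m.+1).
Implicit Types (lam mu nu : part).

Lemma row_mono lam r s :
  in_rect lam -> (r <= s)%N -> (row lam s <= row lam r)%N.
Proof. exact: sorted_geq_nth. Qed.

Lemma part_eqP lam mu :
    (forall (r : 'I_l) (c : 'I_m), (c < row lam r)%N = (c < row mu r)%N) ->
  lam = mu.
Proof.
have aux (a b : part)
    (h : forall (r : 'I_l) (c : 'I_m), (c < row a r)%N = (c < row b r)%N)
    (r : 'I_l) : (row a r <= row b r)%N.
  rewrite leqNgt; apply/negP => hr.
  have hm := leq_trans hr (row_le a r).
  by move: (h r (Ordinal hm)); rewrite /= ltnn hr.
move=> h; apply: row_inj => r hr; apply/eqP; rewrite eqn_leq.
by rewrite (aux _ _ h (Ordinal hr)) (aux _ _ _ (Ordinal hr)).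
Qed.

(* For mu contained in lam: each column of lam/mu is counted at its lowest
   box, which lies in row r - 1. *)
Lemma card_columns lam mu : in_rect lam -> in_rect mu ->
  #|[set c : 'I_m | [exists r : 'I_l, row mu r <= c < row lam r]%N]| =
  (\sum_(0 <= r < l.+1) (prow lam r - maxn (row lam r) (prow mu r)))%N.
Proof.
move=> hlam hmu.
transitivity (\sum_(0 <= r < l.+1) \sum_(c < m)
    ((row lam r <= c < prow lam r) && (prow mu r <= c)))%N; last first.
  apply: eq_big_nat => r _.
  rewrite -(@card_ord_itv m) ?prow_le // -sum1dep_card.
  rewrite [RHS]big_mkcond; apply: eq_bigr => c _; rewrite geq_max.
  by rewrite -andbA [X in _ && X]andbC andbA; case: ifP.
rewrite exchange_big /= -sum1dep_card big_mkcond; apply: eq_bigr => c _.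
case: existsP => [[r /andP[hr1 hr2]] | h].
  have ex : exists r, (c < row lam r)%N by exists r.
  have bd s : (c < row lam s)%N -> (s <= l)%N.
    by apply: contraTT; rewrite -ltnNge => hs; rewrite row_ge // ltnW.
  (* Row s is the lowest row of lam that meets column c, so only the index s + 1 counts it. *)
  case: (ex_maxnP ex bd) => s hs hmax {ex bd}.
  have hs' : (row lam s.+1 <= c)%N.
    by rewrite leqNgt; apply/negP => /hmax; rewrite ltnn.
  rewrite (bigD1_seq s.+1) ?iota_uniq //=; last first.
    rewrite mem_index_iota /= ltnS ltnNge; apply/negP => hls.
    by rewrite row_ge // in hs.
  rewrite hs' hs (leq_trans (row_mono hmu (hmax _ hr2)) hr1) /=.
  rewrite big1 // => -[|k] hk /=.
    by rewrite [(m <= c)%N]leqNgt ltn_ord andbF.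
  have [hks | hsk | e] := ltngtP k s; last by rewrite e eqxx in hk.
    by rewrite [(_ <= c)%N]leqNgt (leq_trans hs) // row_mono.
  have /leq_trans/(_ hs') : (row lam k <= row lam s.+1)%N by rewrite row_mono.
  by rewrite leqNgt => /negbTE ->; rewrite andbF.
symmetry; apply: big1_seq => -[|k];
  rewrite mem_index_iota => /andP[_ /andP[_ hk]] /=.
  by rewrite [(m <= c)%N]leqNgt ltn_ord andbF.
apply/eqP; rewrite eqb0; apply/negP => /andP[/andP[_ h1] h2].
by case: h; exists (Ordinal (hk : (k < l)%N)); rewrite /= h1 h2.
Qed.

(* A filling of a partition inside the rectangle, completed by the value n. *)
Definition rect_filling (n : nat) : finType := {ffun 'I_l * 'I_m -> 'I_n.+1}.

Definition weak n (A : rect_filling n) : bool :=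
  [forall p : 'I_l * 'I_m, forall q : 'I_l * 'I_m,
    (p.1 <= q.1)%N && (p.2 <= q.2)%N ==> (A p <= A q)%N].

Lemma weakP n (A : rect_filling n) :
  reflect (forall (r s : 'I_l) (c d : 'I_m),
             (r <= s)%N -> (c <= d)%N -> (A (r, c) <= A (s, d))%N)
          (weak A).
Proof.
apply: (iffP forallP) => [h r s c d hr hc | h [r c]].
  by have /forallP/(_ (s, d))/implyP := h (r, c); apply; rewrite hr hc.
by apply/forallP => -[s d]; apply/implyP => /andP[]; apply: h.
Qed.

(** Entries start at 0, so these are the boxes holding one of the first i values; [shape A n] is the
    shape of the original filling. *)
Definition shape n (A : rect_filling n) (i : nat) : part :=
  [tuple inord #|[set c : 'I_m | (A (r, c) < i)%N]| | r < l].

Lemma lt_shape n (A : rect_filling n) i (r : 'I_l) (c : 'I_m) : weak A ->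
  (c < row (shape A i) r)%N = (A (r, c) < i)%N.
Proof.
move=> /weakP hA; rewrite row_tnth tnth_mktuple inordK; last first.
  by rewrite ltnS -[X in (_ <= X)%N]card_ord max_card.
apply: (@lt_card_ord _ (fun c => A (r, c) < i)%N) => d e hde.
by apply: leq_ltn_trans; apply: hA.
Qed.

Lemma shape0 n (A : rect_filling n) : shape A 0 = empty_part m l.
Proof.
apply: row_inj => r hr.
rewrite row_empty (row_tnth _ (Ordinal hr)) tnth_mktuple.
by rewrite (_ : [set _ | _] = set0) ?cards0 ?inordK //; apply/setP => c;
  rewrite !inE.
Qed.

Lemma shape_in_rect n (A : rect_filling n) i : weak A -> in_rect (shape A i).
Proof.
move=> hA; apply/in_rectP => r; rewrite leqNgt; apply/negP => h.
have hr : (r.+1 < l)%N.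
  by apply: contraTT h; rewrite -!leqNgt => h; rewrite row_ge.
have hc := leq_trans h (row_le _ _).
have := lt_shape i (Ordinal hr) (Ordinal hc) hA; rewrite /= h => /esym hA'.
have := lt_shape i (Ordinal (ltnW hr)) (Ordinal hc) hA; rewrite /= ltnn.
by move/esym/negP; apply; apply: leq_ltn_trans hA'; move/weakP: hA; apply.
Qed.

Lemma sub_shape n (A : rect_filling n) i j : weak A -> (i <= j)%N ->
  sub_part (shape A i) (shape A j).
Proof.
move=> hA hij; apply/forallP => r; rewrite leqNgt; apply/negP => h.
have hc := leq_trans h (row_le _ _).
have := lt_shape i r (Ordinal hc) hA; rewrite /= h => /esym hA'.
have := lt_shape j r (Ordinal hc) hA; rewrite /= ltnn.
by move/esym/negP; apply; apply: leq_trans hij.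
Qed.

(** * Removal of the largest entry *)

Section Peeling.

Variables (n : nat) (lam : part).

(** The largest entry n is merged with the outer value n + 1, and n becomes the new outer value. *)
Definition peel (A : rect_filling n.+1) : rect_filling n :=
  [ffun p => inord (minn (A p) n)].

(** Inside lam the former outer value n becomes an entry; n + 1 marks the outside of lam. *)
Definition unpeel (A : rect_filling n) : rect_filling n.+1 :=
  [ffun p : 'I_l * 'I_m =>
     inord (if (p.2 < row lam p.1)%N then A p : nat else n.+1)].

Lemma peelE A p : peel A p = minn (A p) n :> nat.
Proof. by rewrite ffunE inordK // ltnS geq_minr. Qed.

Lemma unpeelE A (p : 'I_l * 'I_m) :
  unpeel A p = (if (p.2 < row lam p.1)%N then A p : nat else n.+1) :> nat.
Proof. by rewrite ffunE inordK //; case: ifP => // _; rewrite leqW. Qed.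

Lemma weak_peel A : weak A -> weak (peel A).
Proof.
move=> /weakP hA; apply/weakP => r s c d hr hc; rewrite !peelE.
by have := hA _ _ _ _ hr hc; lia.
Qed.

Lemma shape_peel A i : (i <= n)%N -> shape (peel A) i = shape A i.
Proof.
move=> hi; apply: eq_from_tnth => r; rewrite !tnth_mktuple.
congr (inord #|pred_of_set _|); apply/setP => c; rewrite !inE peelE; lia.
Qed.

Lemma weak_unpeel A : in_rect lam -> weak A -> weak (unpeel A).
Proof.
move=> hlam /weakP hA; apply/weakP => r s c d hr hc; rewrite !unpeelE /=.
case: (ltnP d (row lam s)) => hd; last by case: ifP => // _; rewrite ltnW.
by rewrite (leq_ltn_trans hc) ?hA // (leq_trans hd) // row_mono.
Qed.

Lemma shape_unpeel A : in_rect lam -> weak A -> shape (unpeel A) n.+1 = lam.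
Proof.
move=> hlam hA; apply: part_eqP => r c.
rewrite lt_shape ?weak_unpeel // unpeelE /=.
by case: (c < _)%N; rewrite ?ltnn ?ltn_ord.
Qed.

Lemma unpeelK A : weak A -> sub_part (shape A n) lam -> peel (unpeel A) = A.
Proof.
move=> hA hsub; apply/ffunP => -[r c]; apply: ord_inj; rewrite peelE unpeelE /=.
case: ltnP => hc; first by apply/minn_idPl; rewrite -ltnS.
have : ~~ (A (r, c) < n)%N.
  rewrite -lt_shape // -leqNgt (leq_trans _ hc) //.
  exact: (sub_partP _ _ hsub).
by case: (A (r, c)) => a ha /=; lia.
Qed.

Lemma peelK A : weak A -> shape A n.+1 = lam -> unpeel (peel A) = A.
Proof.
move=> hA hl; apply/ffunP => -[r c]; apply: ord_inj; rewrite unpeelE peelE /=.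
by rewrite -hl lt_shape //; case: (A (r, c)) => a ha /=; case: ltnP; lia.
Qed.

End Peeling.

(** By peeling, a filling of shape lam amounts to a partition mu inside lam and a filling of shape
    mu with one value less. *)
Lemma sum_rect_filling (R : comNzRingType) (t xs : nat -> R) n lam :
  in_rect lam ->
  \sum_(A : rect_filling n | weak A && (shape A n == lam))
     \prod_(i < n) skew_g (xs i) t (shape A i.+1) (shape A i) =
  g_iter t xs n (@empty_delta m l R) lam.
Proof.
elim: n lam => [|n IH] lam hlam /=.
  under eq_bigr do rewrite big_ord0; rewrite /empty_delta.
  have [->|/negbTE hne] := eqVneq lam; last first.
    by rewrite big_pred0 // => A; rewrite shape0 eq_sym hne andbF.
  rewrite (big_pred1 [ffun=> ord0]) // => A; rewrite shape0 eqxx andbT /=.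
  have -> : A = [ffun=> ord0] by apply/ffunP => p; rewrite ord1 [RHS]ord1.
  by rewrite eqxx; apply/weakP => *; rewrite !ffunE.
rewrite /g_op (partition_big (fun A : rect_filling n.+1 => shape A n)
   (fun mu => in_rect mu && sub_part mu lam)) /=; last first.
  move=> A /andP[hA /eqP <-]; rewrite shape_in_rect //.
  exact: sub_shape.
apply: eq_bigr => mu /andP[hmu hsub]; rewrite -IH // mulr_sumr.
rewrite (reindex_onto (unpeel lam) (@peel n)) /=; last first.
  by move=> A /andP[/andP[hA /eqP hs] _]; apply: peelK.
apply: eq_big => [A | A /andP[/andP[/andP[hA /eqP hs] /eqP hs'] /eqP hK]].
  apply/andP/andP => [[/andP[/andP[hA _] hs] /eqP hK] | [hA /eqP hs]].
    by rewrite -hK weak_peel // shape_peel.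
  have hK : peel (unpeel lam A) = A by rewrite unpeelK // hs.
  rewrite hK weak_unpeel // shape_unpeel // eqxx.
  by rewrite -shape_peel // hK hs eqxx.
rewrite big_ord_recr /= hs hs' mulrC; congr (_ * _).
by apply: eq_bigr => i _; rewrite -[in RHS]hK !shape_peel // ltnW.
Qed.

End Tableaux.

(** * Reverse plane partitions and semistandard tableaux *)

Lemma box_inj (L : seq nat) (b b' : box L) :
  brow b = brow b' :> nat -> bcol b = bcol b' :> nat -> b = b'.
Proof.
move=> h1 h2; apply: val_inj; apply: injective_projections; exact: ord_inj.
Qed.

Lemma exists_box (L : seq nat) (r c : nat) :
  sorted geq L -> (c < nth 0%N L r)%N ->
  exists b : box L, brow b = r :> nat /\ bcol b = c :> nat.
Proof.
move=> hL hc.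
have hr : (r < size L)%N.
  by rewrite ltnNge; apply: contraTN hc => hr; rewrite nth_default.
have hc0 : (c < head 0 L)%N.
  by rewrite -nth0; apply: leq_trans hc (sorted_geq_nth hL (leq0n _)).
by exists (exist _ (Ordinal hr, Ordinal hc0) hc).
Qed.

(** The box in the row of [b] and the column of [b'] lies in the shape, so the two monotonicities
    combine through it. *)
Lemma rppP (L : seq nat) n (T : filling L n) : sorted geq L ->
  reflect (forall b b', (brow b <= brow b')%N -> (bcol b <= bcol b')%N ->
             (T b <= T b')%N)
          (rpp T).
Proof.
move=> hL; apply: (iffP andP) => [[/forallP hr /forallP hc] b b' hbr hbc | h].
  have hcor : (bcol b' < nth 0%N L (brow b))%N.
    exact: leq_trans (valP b') (sorted_geq_nth hL hbr).
  have [b1 [e1 e2]] := exists_box hL hcor.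
  have /forallP/(_ b1)/implyP h1 := hr b.
  have /forallP/(_ b')/implyP h2 := hc b1.
  apply: leq_trans (h1 _) (h2 _); last by rewrite e1 hbr andbT -val_eqE /= e2.
  by rewrite e2 hbc andbT -val_eqE /= e1.
by split; apply/forallP => b; apply/forallP => b';
  apply/implyP => /andP[/eqP e hb]; apply: h; rewrite // e.
Qed.

(** * Reverse plane partitions as weak fillings of the rectangle *)

Section Encoding.

Variables (m l n : nat) (lam : l.-tuple 'I_m.+1).
Hypothesis hlam : in_rect lam.

Local Notation L := (map val lam).

Lemma size_parts : size L = l.
Proof. by rewrite size_map size_tuple. Qed.

Lemma head_parts : (head 0%N L <= m)%N.
Proof. by rewrite -nth0; apply: row_le. Qed.

Definition box_pos (b : box L) : 'I_l * 'I_m :=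
  (cast_ord size_parts (brow b), widen_ord head_parts (bcol b)).

Lemma box_pos_inj : injective box_pos.
Proof. by move=> b b' [h1 h2]; apply: box_inj. Qed.

Lemma box_posP (b : box L) : ((box_pos b).2 < row lam (box_pos b).1)%N.
Proof. exact: (valP b). Qed.

Lemma box_at (p : 'I_l * 'I_m) :
  (p.2 < row lam p.1)%N -> exists b, box_pos b = p.
Proof.
move=> /(exists_box hlam)[b [h1 h2]]; exists b.
by apply: injective_projections; apply: ord_inj.
Qed.

Definition encode (T : filling L n) : rect_filling m l n :=
  [ffun p =>
     inord (if [pick b | box_pos b == p] is Some b then T b : nat else n)].

Lemma encode_box T b : encode T (box_pos b) = T b :> nat.
Proof.
rewrite ffunE; case: pickP => [b' /eqP/box_pos_inj-> | /(_ b)]; last first.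
  by rewrite eqxx.
by rewrite inordK // ltnW ?ltnS.
Qed.

Lemma encode_out T (p : 'I_l * 'I_m) :
  (row lam p.1 <= p.2)%N -> encode T p = n :> nat.
Proof.
move=> h; rewrite ffunE; case: pickP => [b /eqP hb | _]; last by rewrite inordK.
by have := box_posP b; rewrite hb ltnNge h.
Qed.

Lemma encode_lt T (p : 'I_l * 'I_m) :
  (encode T p < n)%N = (p.2 < row lam p.1)%N.
Proof.
case: (ltnP p.2) => h; last by rewrite encode_out // ltnn.
by have [b <-] := box_at h; rewrite encode_box ltn_ord.
Qed.

Lemma encode_inj : injective encode.
Proof.
move=> T T' h; apply/ffunP => b; apply: ord_inj.
by rewrite -!encode_box h.
Qed.

Lemma rpp_encode T : rpp T = weak (encode T).
Proof.
apply/(rppP T hlam)/forallP => [h p | h b b' hr hc]; last first.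
  have /forallP/(_ (box_pos b'))/implyP := h (box_pos b).
  by rewrite !encode_box; apply; rewrite /= hr hc.
apply/forallP => q; apply/implyP => /andP[hr hc].
have [hq | hq] := ltnP q.2 (row lam q.1); last first.
  by rewrite (encode_out T hq) -ltnS.
have hp : (p.2 < row lam p.1)%N.
  exact: leq_ltn_trans hc (leq_trans hq (row_mono hlam hr)).
have [b1 e1] := box_at hp; have [b2 e2] := box_at hq; subst p q.
by rewrite !encode_box h.
Qed.

Lemma shape_encode T : rpp T -> shape (encode T) n = lam.
Proof.
rewrite rpp_encode => h; apply: part_eqP => r c.
by rewrite lt_shape // encode_lt.
Qed.

Lemma encode_surj (A : rect_filling m l n) : weak A -> shape A n = lam ->
  exists T : filling L n, encode T = A.
Proof.
move=> hA hs; have lt_A (p : 'I_l * 'I_m) : (A p < n)%N = (p.2 < row lam p.1)%N.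
  by case: p => r c; rewrite -lt_shape // hs.
have hb b : (A (box_pos b) < n)%N by rewrite lt_A box_posP.
exists [ffun b => Ordinal (hb b)]; apply/ffunP => p; apply: ord_inj.
have [h | h] := ltnP p.2 (row lam p.1).
  by have [b <-] := box_at h; rewrite encode_box ffunE.
rewrite encode_out //; apply/eqP; rewrite eqn_leq leqNgt lt_A -leqNgt h /=.
by rewrite -ltnS.
Qed.

(** The boxes with entry i fill the skew shape between two consecutive shapes, whose columns
    [card_columns] counts. *)
Lemma num_colsE T (i : 'I_n) : rpp T ->
  num_cols T i = (\sum_(0 <= r < l.+1)
    (prow (shape (encode T) i.+1) r -
     maxn (row (shape (encode T) i.+1) r) (prow (shape (encode T) i) r)))%N.
Proof.
rewrite rpp_encode => hA; rewrite -card_columns ?shape_in_rect //.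
have widen_inj : injective (widen_ord head_parts).
  by move=> a b /(congr1 val) /= h; apply: ord_inj.
rewrite /num_cols -(card_imset _ widen_inj).
apply: eq_card => c; rewrite inE.
have vE (r : 'I_l) (c' : 'I_m) :
    (row (shape (encode T) i) r <= c' < row (shape (encode T) i.+1) r)%N =
    (encode T (r, c') == i :> nat).
  by rewrite leqNgt !lt_shape // ltnS -leqNgt eqn_leq andbC.
apply/imsetP/existsP => [[d] | [r]].
  rewrite inE => /existsP[b /andP[/eqP <- /eqP e]] ->; exists (box_pos b).1.
  by rewrite vE -/(box_pos b) encode_box e.
rewrite vE => /eqP e.
have : ((r, c).2 < row lam (r, c).1)%N by rewrite -(encode_lt T) e.
move=> /box_at[b eb]; exists (bcol b); last by case: eb => _ <-.
rewrite inE; apply/existsP; exists b; rewrite eqxx -val_eqE /=.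
by rewrite -encode_box eb e.
Qed.

(** The summand for i counts the columns whose entry in row r is at least i and in row r + 1 at most
    i; as columns weakly increase, both equal i. *)
Lemma num_repeatsE T r : rpp T ->
  num_repeats T r = (\sum_(i < n) (row (shape (encode T) i.+1) r.+1 -
                                   row (shape (encode T) i) r))%N.
Proof.
rewrite rpp_encode => hA; have [hr | hr] := ltnP r.+1 l; last first.
  rewrite big1 => [|i _]; last by rewrite row_ge.
  apply/eqP; rewrite cards_eq0; apply/eqP/setP => b; rewrite !inE.
  apply/negP => /andP[_ /existsP[b' /and3P[/eqP e _ _]]].
  by have := ltn_ord (brow b'); rewrite e size_parts ltnNge hr.
pose r0 := Ordinal (ltnW hr); pose r1 := Ordinal hr.
(* The bound n excludes columns where both positions lie outside the shape. *)
pose S := [set c : 'I_m | (encode T (r0, c) == encode T (r1, c)) &&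
                          (encode T (r1, c) < n)%N].
transitivity #|S|.
  rewrite /num_repeats.
  rewrite -(@card_in_imset _ _ (fun b => (box_pos b).2)); last first.
    move=> b b'; rewrite !inE => /andP[/eqP hb _] /andP[/eqP hb' _].
    move=> /(congr1 val) /= e; by apply: box_inj; rewrite // hb.
  apply: eq_card => c; rewrite inE.
  apply/imsetP/andP => [[b] | [/eqP e hc]].
    rewrite inE => /andP[/eqP hb /existsP[b']].
    move=> /and3P[/eqP hb' /eqP ec /eqP eT] ->.
    have <- : box_pos b = (r0, (box_pos b).2).
      by apply: injective_projections => //; apply: ord_inj.
    have <- : box_pos b' = (r1, (box_pos b).2).
      by apply: injective_projections; apply: ord_inj; rewrite //= ec.
    by rewrite -val_eqE /= !encode_box eT ltn_ord.
  have [b' e'] : exists b', box_pos b' = (r1, c).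
    by apply: box_at; rewrite -(encode_lt T).
  have [b eb] : exists b, box_pos b = (r0, c).
    by apply: box_at; rewrite -(encode_lt T) e.
  exists b; last by rewrite eb.
  have eb1 := congr1 (fun p => val p.1) eb.
  have eb2 := congr1 (fun p => val p.2) eb.
  have eb1' := congr1 (fun p => val p.1) e'.
  have eb2' := congr1 (fun p => val p.2) e'.
  rewrite inE; apply/andP; split; first exact/eqP.
  apply/existsP; exists b'; apply/and3P; split; first exact/eqP.
    by rewrite -val_eqE /=; apply/eqP; rewrite [LHS]eb2' [RHS]eb2.
  by rewrite -val_eqE /= -!encode_box eb e' e.
transitivity (\sum_(i < n) \sum_(c < m)
    ((row (shape (encode T) i) r0 <= c <
      row (shape (encode T) i.+1) r1)%N : nat))%N; last first.
  apply: eq_bigr => i _; rewrite -(@card_ord_itv m) ?row_le // -sum1dep_card.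
  by rewrite [RHS]big_mkcond; apply: eq_bigr => c _; case: ifP.
rewrite exchange_big /= -sum1dep_card big_mkcond; apply: eq_bigr => c _.
have hle : (encode T (r0, c) <= encode T (r1, c))%N.
  by move/weakP: hA; apply; rewrite //= leqnSn.
under eq_bigr => i _ do
  rewrite leqNgt (lt_shape i r0 c hA) (lt_shape i.+1 r1 c hA).
case: ifP => [/andP[/eqP e hc] | h].
  rewrite (bigD1 (Ordinal hc)) //= e ltnn ltnSn big1 // => i.
  by rewrite -val_eqE /= => /negbTE hi; apply/eqP; rewrite eqb0; lia.
symmetry; apply: big1 => i _; apply/eqP; rewrite eqb0; apply: contraFN h => hi.
case: (encode T (r0, c)) (encode T (r1, c)) hle hi => [a ha] [b hb] /=.
by rewrite -val_eqE /=; have := ltn_ord i; lia.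
Qed.

Lemma dual_grothendieckE (R : comNzRingType) (t xs : nat -> R) :
  dual_grothendieck L (fun i : 'I_n => xs i) (fun r : 'I_l.-1 => t r.+1) =
  g_iter t xs n (@empty_delta m l R) lam.
Proof.
rewrite -sum_rect_filling //.
transitivity (\sum_(A in encode @: [set T | rpp T])
    \prod_(i < n) skew_g (xs i) t (shape A i.+1) (shape A i)); last first.
  apply: eq_bigl => A; apply/imsetP/andP => [[T] | [hA /eqP hs]].
    by rewrite inE => hT ->; rewrite -rpp_encode shape_encode.
  have [T eT] := encode_surj hA hs; exists T => //.
  by rewrite inE rpp_encode eT.
rewrite big_imset => [|T T' _ _]; last exact: encode_inj.
rewrite /dual_grothendieck /=; apply: eq_big => T; first by rewrite inE.
move=> hT; rewrite /skew_g.
under [RHS]eq_bigr do rewrite big_split.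
rewrite [RHS]big_split mulrC /=; congr (_ * _).
  by apply: eq_bigr => i _; rewrite num_colsE // expr_sum.
(* The factor of index 0 is 1, the top row being at most m. *)
rewrite exchange_big /= big_ltn // [X in _ = X * _]big1 => [|i _]; last first.
  have := row_le (shape (encode T) i.+1) 0.
  by rewrite -subn_eq0 => /eqP /= ->.
(* From row [l.-1] on there is no row below, so those factors are 1. *)
rewrite mul1r big_add1 /= (@big_cat_nat _ _ _ l.-1) ?leq_pred //=.
rewrite [X in _ = _ * X]big_nat_cond.
rewrite [X in _ = _ * X]big1 ?mulr1 => [|r /andP[/andP[hr _] _]].
  rewrite -(big_mkord xpredT (fun r => t r.+1 ^+ num_repeats T r)).
  by apply: eq_big_nat => r _; rewrite num_repeatsE // expr_sum.
apply: big1 => i _; rewrite row_ge //.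
by rewrite -ltnS in hr; apply: leq_trans hr; apply: leqSpred.
Qed.

End Encoding.

(** * Semistandard tableaux as the case t = 0 *)

Lemma col_strict_lt (L : seq nat) n (T : filling L n) b b' :
  col_strict T -> bcol b = bcol b' -> (brow b < brow b')%N -> (T b < T b')%N.
Proof.
move=> /forallP/(_ b)/forallP/(_ b')/implyP h e hb.
by apply: h; rewrite e eqxx hb.
Qed.

(** A weakly increasing column is strict once no two adjacent entries agree; at most k rows have a
    row below them. *)
Lemma ssytE (L : seq nat) n (T : filling L n) k :
  sorted geq L -> (size L <= k.+1)%N ->
  ssyt T = rpp T && [forall r : 'I_k, num_repeats T r == 0%N].
Proof.
move=> hL hk; rewrite /ssyt /rpp -andbA; case hrow: (row_weak T) => //=.
apply/idP/andP => [h | [hcol /forallP h]].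
  have lt_T := col_strict_lt h.
  split.
    apply/forallP => b; apply/forallP => b'; apply/implyP => /andP[/eqP e].
    rewrite leq_eqVlt => /orP[/eqP hb | hb]; last by rewrite ltnW ?lt_T.
    by rewrite (@box_inj _ b b') // e.
  apply/forallP => r; rewrite cards_eq0; apply/eqP/setP => b; rewrite !inE.
  apply/negP => /andP[/eqP hb /existsP[b' /and3P[/eqP hb' /eqP hc /eqP eT]]].
  by have := lt_T b b' (esym hc); rewrite hb hb' eT ltnn => /(_ (leqnn _)).
have rppT : rpp T by rewrite /rpp hrow.
apply/forallP => b; apply/forallP => b'; apply/implyP => /andP[/eqP hc hb].
(* The box [b1] directly below [b] separates the entries: T b < T b1 <= T b'. *)
have hcor : (bcol b < nth 0%N L (brow b).+1)%N.
  by rewrite hc; apply: leq_trans (valP b') (sorted_geq_nth hL hb).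
have [b1 [e1 e2]] := exists_box hL hcor.
have hr : (brow b < k)%N.
  by rewrite -ltnS -[(brow b).+1]e1; apply: leq_trans (ltn_ord _) hk.
have hT := elimT (rppP T hL) rppT.
have le_b : (T b <= T b1)%N by rewrite hT // ?e1 ?e2.
have le_b' : (T b1 <= T b')%N by rewrite hT ?e1 ?e2 // hc.
apply: leq_trans le_b'; rewrite ltn_neqAle le_b andbT; apply/negP => /eqP eT.
have := h (Ordinal hr); rewrite cards_eq0 => /eqP/setP/(_ b).
rewrite !inE eqxx /= => /negbT/negP; apply; apply/existsP; exists b1.
by rewrite e1 eqxx -!val_eqE /= e2 eT !eqxx.
Qed.

(** A strict column contains each value at most once. *)
Lemma num_cols_ssyt (L : seq nat) n (T : filling L n) (i : 'I_n) : ssyt T ->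
  num_cols T i = #|[set b | T b == i]|.
Proof.
case/andP=> _ h; rewrite -(@card_in_imset _ _ (@bcol L)).
  apply: eq_card => c; rewrite inE; apply/existsP/imsetP => -[b].
    by move=> /andP[/eqP <- hb]; exists b; rewrite // inE.
  by rewrite inE => hb ->; exists b; rewrite eqxx.
have lt_T := col_strict_lt h.
move=> b b'; rewrite !inE => /eqP e /eqP e' hc; apply: box_inj; rewrite ?hc //.
case: (ltngtP (brow b) (brow b')) => // hb.
  by have := lt_T _ _ hc hb; rewrite e e' ltnn.
by have := lt_T _ _ (esym hc) hb; rewrite e e' ltnn.
Qed.

(* At t = 0 a reverse plane partition may not repeat an entry in a column. *)
Lemma schurE (R : comNzRingType) (L : seq nat) n k (z : 'I_n -> R) :
    sorted geq L -> (size L <= k.+1)%N ->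
  schur L z = dual_grothendieck L z (fun _ : 'I_k => 0).
Proof.
move=> hL hk; rewrite /schur /dual_grothendieck big_mkcond [RHS]big_mkcond.
apply: eq_bigr => T _; case: (boolP (ssyt T)) => hT; last first.
  case: ifP => // hrpp; move: hT.
  rewrite (ssytE T hL hk) hrpp /= => /forallPn[r hr].
  by rewrite (bigD1 r) //= expr0n (negbTE hr) !mul0r.
have := hT; rewrite (ssytE T hL hk) => /andP[-> /forallP h].
rewrite [X in _ = X * _]big1 ?mul1r => [|r _]; last first.
  by rewrite (eqP (h r)) expr0.
rewrite (partition_big T xpredT) //=; apply: eq_bigr => i _.
rewrite (eq_bigr (fun=> z i)) => [|b /eqP-> //].
by rewrite prodr_const num_cols_ssyt // cardsE.
Qed.

Lemma eq_dual_grothendieck (R : comNzRingType) (L : seq nat) n k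
    (x x' : 'I_n -> R) (t t' : 'I_k -> R) : x =1 x' -> t =1 t' ->
  dual_grothendieck L x t = dual_grothendieck L x' t'.
Proof.
move=> hx ht; apply: eq_bigr => T _; congr (_ * _).
  by apply: eq_bigr => r _; rewrite ht.
by apply: eq_bigr => i _; rewrite hx.
Qed.

(** * The identity in the polynomial ring *)

Theorem corollary3p14 (m l n : nat) (hl : (1 <= l)%N) (hm : (l <= m)%N) :
  let x (i : 'I_n) : {mpoly int[n + l]} := 'X_(lshift l i) in
  let t (i : 'I_l) : {mpoly int[n + l]} := 'X_(rshift n i) in
  schur (nseq l m) (fun k : 'I_(n + l) => 'X_k : {mpoly int[n + l]}) =
  \sum_(lam : l.-tuple 'I_m.+1 | in_rect lam)
    (\prod_(i < l) t i ^+ (m - tnth lam i)%N) *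
    dual_grothendieck (map val lam) x
      (fun r : 'I_l.-1 => t (widen_ord (leq_pred l) r)).
Proof.
move=> x t.
(* All indeterminates form one sequence over the naturals, continued by 0. *)
pose z (i : nat) : {mpoly int[n + l]} := if insub i is Some k then 'X_k else 0.
have zE (k : 'I_(n + l)) : 'X_k = z k by rewrite /z valK.
(* The operators number parameters from 1, so that of row i is [t' i.+1]. *)
pose t' i := z (n + i.-1)%N.
have tE (i : 'I_l) : t i = t' i.+1 by rewrite /t zE.
have -> : nseq l m = map val (rect_part m l).
  apply: (@eq_from_nth _ 0%N) => [|i]; rewrite size_nseq ?size_parts // => hi.
  by rewrite nth_nseq hi -[RHS]/(row _ _) row_rect.
(* The left side becomes g of the rectangle in all n + l variables at t = 0, hence an iterate of
   strip operators. *)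
rewrite (schurE (k := l.-1) _ (in_rect_rect m l)); last first.
  by rewrite size_parts prednK.
rewrite (eq_dual_grothendieck _ zE (fun=> erefl)).
rewrite (dual_grothendieckE _ (in_rect_rect m l) (fun=> 0) z).
rewrite g_iter_schur ?in_rect_rect //.
transitivity (schur_iter
    (fun i => if (i < n)%N then z i else t' (i - n).+1) (n + l)
    (@empty_delta m l {mpoly int[n + l]}) (rect_part m l)).
  apply: eq_schur_iter; rewrite ?in_rect_rect // => i _; case: ltnP => // hi.
  by rewrite /t' /= subnKC.
rewrite -sum_g_rect //; apply: eq_bigr => lam hlam; congr (_ * _).
  by apply: eq_bigr => i _; rewrite tE.
rewrite -(dual_grothendieckE _ hlam); apply: eq_dual_grothendieck => [i | r].
  by rewrite /x zE.
by rewrite tE.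
Qed.
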